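(* Let $H=\langle n_1,n_2,n_3,n_4\rangle$ be an almost symmetric numerical semigroup minimally generated by $4$ elements, of type $t$, for which $I_H$ is generated by $m=3(t-1)$ elements. Then $I_H$ is generated by $\mathrm{RF}$-relations.
   Context: A numerical semigroup is a submonoid $H\subset\mathbb N$ with $0\in H$ and $\mathbb N\setminus H$ finite; we assume $H\ne\mathbb N$. $\mathrm F(H)=\max(\mathbb N\setminus H)$; $\mathrm{PF}(H)=\{f\in\mathbb Z\setminus H : f+n_i\in H\text{ for all }i\}$; $\mathrm{PF}'(H)=\mathrm{PF}(H)\setminus\{\mathrm F(H)\}$; the type of $H$ is $|\mathrm{PF}(H)|$; $H$ is almost symmetric if $2|\mathbb N\setminus H|=\mathrm F(H)+|\mathrm{PF}(H)|$. $K$ is a field and $I_H$ is the kernel of the $K$-algebra map $K[x_1,\dots,x_4]\to K[t]$, $x_i\mapsto t^{n_i}$. For $f\in\mathrm{PF}(H)$, a row-factorization matrix of $f$ is a $4\times 4$ integer matrix $(a_{ij})$ with $a_{ii}=-1$, $a_{ij}\in\mathbb N$ for $i\neq j$, and $\sum_j a_{ij}n_j=f$ for every $i$ (not necessarily unique). If $\mathbf a_1,\dots,\mathbf a_4$ are the rows of a row-factorization matrix of $f$ and $\mathbf a_{ij}=\mathbf a_i-\mathbf a_j$ ($i<j$), the binomial $x^{\mathbf a_{ij}^+}-x^{\mathbf a_{ij}^-}\in I_H$ is called an $\mathrm{RF}(f)$-relation; here $\mathbf a^+$ is obtained from $\mathbf a$ by replacing negative entries by $0$ and $\mathbf a^-=\mathbf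 a^+-\mathbf a$. An $\mathrm{RF}$-relation is an $\mathrm{RF}(f)$-relation for some $f\in\mathrm{PF}'(H)$. *)

(* Defs.v *)
From HB Require Import structures.
From mathcomp Require Import all_boot all_order all_algebra finmap.
From mathcomp Require Import boolp classical_sets functions cardinality.
From mathcomp Require Import mpoly.

Set Implicit Arguments.
Unset Strict Implicit.
Unset Printing Implicit Defensive.

Import Order.TTheory GRing.Theory Num.Theory.

Local Open Scope classical_set_scope.
Local Open Scope ring_scope.

Definition numerical_semigroup (H : set nat) : Prop :=
  [/\ H 0%N,
      forall a b, H a -> H b -> H (a + b)%N,
      finite_set (~` H)
    & H <> setT].

(* The submonoid of nat generated by the n i with i in A. *)
Definition monoid_gen (e : nat) (n : 'I_e -> nat) (A : {set 'I_e}) : set nat :=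
  [set h | exists a : 'I_e -> nat, h = (\sum_(i in A) a i * n i)%N].

Definition minimally_generated (e : nat) (n : 'I_e -> nat) (H : set nat) :
    Prop :=
  H = monoid_gen n [set: 'I_e]%SET
  /\ forall A : {set 'I_e}, A \proper [set: 'I_e]%SET -> monoid_gen n A <> H.

(* The number of elements of A; meaningful only for finite A (it is 0 if A is
   infinite).  It is only applied to ~` H and to PF n H, which are finite for
   a numerical semigroup. *)
Definition card_of (T : choiceType) (A : set T) : nat := #|` fset_set A|.

Definition frobenius (H : set nat) : nat :=
  (\max_(x <- fset_set (~` H)) x)%N.

(* H regarded as a subset of the integers. *)
Definition int_set (H : set nat) : set int := [set h%:Z | h in H].

Definition PF (e : nat) (n : 'I_e -> nat) (H : set nat) : set int :=
  [set f | ~ int_set H f /\ forall i, int_set H (f + (n i)%:Z)].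

Definition PF' (e : nat) (n : 'I_e -> nat) (H : set nat) : set int :=
  PF n H `\ (frobenius H)%:Z.

Definition sg_type (e : nat) (n : 'I_e -> nat) (H : set nat) : nat :=
  card_of (PF n H).

Definition almost_symmetric (e : nat) (n : 'I_e -> nat) (H : set nat) : Prop :=
  (2 * card_of (~` H) = frobenius H + sg_type n H)%N.

Section Toric.
Variables (K : fieldType) (e : nat).

Definition param_map (n : 'I_e -> nat) (p : {mpoly K[e]}) : {poly K} :=
  mmap (@polyC K) (fun i => 'X^(n i)) p.

Definition toric_ideal (n : 'I_e -> nat) : set {mpoly K[e]} :=
  [set p | param_map n p = 0].

Definition ideal_gen (S : set {mpoly K[e]}) : set {mpoly K[e]} :=
  [set p | exists (k : nat) (c s : 'I_k -> {mpoly K[e]}),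
     (forall i, S (s i)) /\ p = \sum_(i < k) c i * s i].

Definition generated_by (I : set {mpoly K[e]}) (m : nat) : Prop :=
  exists g : 'I_m -> {mpoly K[e]}, ideal_gen (range g) = I.

Definition is_RF_matrix (n : 'I_e -> nat) (f : int) (A : 'M[int]_e) : Prop :=
  [/\ forall i, A i i = -1,
      forall i j, i != j -> 0 <= A i j
    & forall i, \sum_j A i j * (n j)%:Z = f].

Definition pos_part (a : 'rV[int]_e) : 'rV[int]_e := map_mx (Num.max 0) a.

Definition neg_part (a : 'rV[int]_e) : 'rV[int]_e := pos_part a - a.

(* x^a for a vector a with nonnegative entries; the absolute value only serves
   to read these entries as natural numbers. *)
Definition xpow (a : 'rV[int]_e) : {mpoly K[e]} :=
  'X_[ [multinom `|a ord0 j|%N | j < e] ].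

Definition RF_relation_of (n : 'I_e -> nat) (f : int) : set {mpoly K[e]} :=
  [set p | exists (A : 'M[int]_e) (i j : 'I_e),
     [/\ is_RF_matrix n f A, (i < j)%N
       & p = xpow (pos_part (row i A - row j A))
             - xpow (neg_part (row i A - row j A))]].

Definition RF_relation (n : 'I_e -> nat) (H : set nat) : set {mpoly K[e]} :=
  [set p | exists2 f, PF' n H f & RF_relation_of n f p].

End Toric.

Arguments toric_ideal K {e} n.
Arguments RF_relation K {e} n H.

(* Main.v *)
Require Import Defs.
From HB Require Import structures.
From mathcomp Require Import all_boot all_order all_algebra finmap zify.
From mathcomp Require Import boolp classical_sets functions cardinality.
From mathcomp Require Import mpoly.

(* For g in Z let D_g be the simplicial complex on the four generators whose
   faces are the S with g - n_S in H, where n_S is the sum of the n_i with i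
   in S. The number of generators of I_H is at least the sum over g of b_0(D_g),
   the number of components of D_g minus one.  Almost symmetry says that
   x is not in H iff F(H) - x is in H or in PF'(H); hence the Alexander dual
   of D_g is D_{F(H)+N-g}, N the sum of the n_i, enlarged by the faces S with
   F(H)+N-g - n_S in PF'(H). Summing the Euler characteristics of all the D_g,
   which add up to 0, and counting the faces added (every f in PF'(H) adds an
   isolated vertex in each of the degrees f + n_i) shows that adding to D_g
   only the new edges ij, those with g - n_i - n_j in PF'(H), decreases the
   sum of the b_0(D_g) by exactly 3(t-1). If I_H has 3(t-1) generators, nothing
   is left: the new edges connect every D_g. As such an edge is an
   RF-relation in degree g, all monomials of the same degree are congruent
   modulo the RF-relations, by induction on the degree. *)

Set Implicit Arguments.
Unset Strict Implicit.
Unset Printing Implicit Defensive.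

Import Order.TTheory GRing.Theory Num.Theory.

(** * Graphs and simplicial complexes on four vertices *)

Definition step (e : rel nat) (r : pred nat) : pred nat :=
  fun j => r j || has (fun k => r k && e k j) (iota 0 4).

Lemma stepE (e : rel nat) (r : pred nat) j :
  step e r j = r j || has (fun k => r k && e k j) (iota 0 4).
Proof. by []. Qed.

(* Three steps suffice as the vertices are 0, 1, 2, 3. *)
Definition conn (e : rel nat) (i : nat) : pred nat := iter 3 (step e) (pred1 i).

Lemma conn_refl (e : rel nat) i : conn e i i.
Proof. by rewrite /conn /= !stepE /= eqxx. Qed.

Definition nonroot (v : pred nat) (e : rel nat) (i : nat) : bool :=
  [&& v i, has v (iota 0 i) & ~~ has (conn e i) (iota 0 i)].

(* The number of components minus one (0 for the empty graph): it counts the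
   least vertices of all components but the first one. *)
Definition b0 (v : pred nat) (e : rel nat) : nat :=
  nonroot v e 0 + nonroot v e 1 + nonroot v e 2 + nonroot v e 3.

(** A quantifier over [bool] that computes: nested instances enumerate all small graphs and
    complexes under [vm_compute]. *)
Definition all_bool (P : bool -> bool) : bool := if P true then P false else false.

Lemma all_boolP (P : bool -> bool) : all_bool P -> forall b, P b.
Proof. by rewrite /all_bool; case E : (P true) => // H [] //; rewrite E. Qed.

Definition vtbl (v0 v1 v2 v3 : bool) : pred nat :=
  fun i => nth false [:: v0; v1; v2; v3] i.
Definition etbl (e01 e02 e03 e12 e13 e23 : bool) : rel nat := fun i j =>
  nth false (nth [::] [:: [:: false; e01; e02; e03]; [:: e01; false; e12; e13];
    [:: e02; e12; false; e23]; [:: e03; e13; e23; false]] i) j.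

Definition graph4 (e : rel nat) : Prop :=
  (forall i, e i i = false) /\ (forall i j, e i j = e j i).

(** A loopless symmetric relation on four vertices is its table of six values, which reduces facts
    about [conn] and [b0] to a finite enumeration. *)
Lemma etblE (e : rel nat) i j : graph4 e -> i < 4 -> j < 4 ->
  e i j = etbl (e 0 1) (e 0 2) (e 0 3) (e 1 2) (e 1 3) (e 2 3) i j.
Proof.
case=> e0 es.
by case: i => [|[|[|[|i]]]] //; case: j => [|[|[|[|j]]]] // _ _; rewrite ?e0 // es.
Qed.

Lemma eq_conn (e e' : rel nat) i j :
  (forall k l, k < 4 -> l < 4 -> e k l = e' k l) -> i < 4 -> j < 4 ->
  conn e i j = conn e' i j.
Proof.
move=> E i4; rewrite /conn.
have R m : forall j, j < 4 ->
    iter m (step e) (pred1 i) j = iter m (step e') (pred1 i) j.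
  elim: m => //= m IH l l4; rewrite !stepE IH //; congr (_ || _); apply: eq_in_has => k.
  by rewrite mem_iota => k4; rewrite IH ?E.
exact: R.
Qed.

Lemma eq_b0 (v v' : pred nat) (e e' : rel nat) :
  (forall i, i < 4 -> v i = v' i) ->
  (forall k l, k < 4 -> l < 4 -> e k l = e' k l) -> b0 v e = b0 v' e'.
Proof.
move=> V E.
have S i : i < 4 -> nonroot v e i = nonroot v' e' i.
  move=> i4; rewrite /nonroot V //; congr [&& _, _ & ~~ _]; apply: eq_in_has => k;
  rewrite mem_iota => /= ki; first by rewrite V // (ltn_trans ki).
  by apply: eq_conn => //; rewrite (ltn_trans ki).
by rewrite /b0 !S.
Qed.

Lemma conn_ind (e : rel nat) (P : nat -> Prop) i j :
  P i -> (forall k l, k < 4 -> l < 4 -> P k -> e k l -> P l) ->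
  j < 4 -> conn e i j -> P j.
Proof.
move=> Pi S; have R m : forall j, j < 4 -> iter m (step e) (pred1 i) j -> P j.
  elim: m => [|m IH] l l4; first by move/eqP->.
  rewrite iterS stepE; case/orP=> [/IH|/hasP[k]]; first exact.
  by rewrite mem_iota => k4 /andP[/IH Pk ekl]; apply: S ekl => //; apply: Pk.
exact: R.
Qed.

(** Enumeration of the [2 ^ 6] graphs. Symmetry and closure under edges are what make [conn g i] the
    full component of [i]. *)
Lemma conn_check :
  all_bool (fun a => all_bool (fun b => all_bool (fun c => all_bool (fun d =>
  all_bool (fun e => all_bool (fun f => let g := etbl a b c d e f in
    all (fun i => all (fun k => if conn g i k then
      conn g k i && all (fun l => if g k l then conn g i l else true) (iota 0 4)
      else true) (iota 0 4)) (iota 0 4))))))).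
Proof. by vm_compute. Qed.

Lemma conn_sym_closed (e : rel nat) i k : graph4 e -> (i < 4)%N -> (k < 4)%N ->
  conn e i k -> conn e k i /\ forall l, (l < 4)%N -> e k l -> conn e i l.
Proof.
move=> G i4 k4; have E := fun k l => @etblE e k l G.
rewrite !(eq_conn E) // => c1.
move/all_boolP/(_ (e 0 1))/all_boolP/(_ (e 0 2))/all_boolP/(_ (e 0 3)): conn_check.
move/all_boolP/(_ (e 1 2))/all_boolP/(_ (e 1 3))/all_boolP/(_ (e 2 3)).
move/allP/(_ i); rewrite mem_iota => /(_ i4).
move/allP/(_ k); rewrite mem_iota c1 => /(_ k4)/andP[-> /allP H].
split=> // l l4; rewrite (E k l) // (eq_conn E) // => c2.
by have := H l; rewrite mem_iota c2 => /(_ l4).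
Qed.

(* A family of subsets of the four vertices, given by the truth values of
   [0 \in S], [1 \in S], [2 \in S], [3 \in S]. *)
Definition complex := bool -> bool -> bool -> bool -> bool.
Definition vert (D : complex) : pred nat :=
  fun i => D (i == 0) (i == 1) (i == 2) (i == 3).
Definition edge (D : complex) : rel nat := fun i j =>
  if i == j then false else
  D ((i == 0) || (j == 0)) ((i == 1) || (j == 1)) ((i == 2) || (j == 2))
    ((i == 3) || (j == 3)).
Definition dual (D : complex) : complex :=
  fun a b c d => ~~ D (~~ a) (~~ b) (~~ c) (~~ d).

(** [evens] and [odds] sort the faces by the parity of their cardinality, the empty face included;
    their difference is, up to sign, the reduced Euler characteristic. *)
Definition evens (D : complex) : nat :=
  D false false false false + D true true false false + D true false true false
  + D true false false true + D false true true false + D false true false true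
  + D false false true true + D true true true true.
Definition odds (D : complex) : nat :=
  D true false false false + D false true false false + D false false true false
  + D false false false true + D true true true false + D true true false true
  + D true false true true + D false true true true.
(** For a complex, this is the case of nonzero reduced homology in degree -1. *)
Definition only_empty (D : complex) : bool :=
  D false false false false && ~~ has (vert D) (iota 0 4).
Definition sphere (D : complex) : bool :=
  [&& ~~ D true true true true, D false true true true, D true false true true,
      D true true false true & D true true true false].

Definition is_complex (D : complex) : Prop := forall a b c d a' b' c' d',
  (a' ==> a) && (b' ==> b) && (c' ==> c) && (d' ==> d) -> D a b c d -> D a' b' c' d'.

Definition ctbl (x x0 x1 x2 x3 x01 x02 x03 x12 x13 x23 x012 x013 x023 x123 x0123
    : bool) : complex :=
  fun a b c d =>
  if a then (if b then (if c then (if d then x0123 else x012)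
                        else (if d then x013 else x01))
                  else (if c then (if d then x023 else x02) else (if d then x03 else x0)))
  else (if b then (if c then (if d then x123 else x12) else (if d then x13 else x1))
                  else (if c then (if d then x23 else x2) else (if d then x3 else x))).

(* The reduced Euler characteristic of [D]: [b_1 D] is [b_0 (dual D)] by
   Alexander duality, and [b_2 D] is nonzero only for the hollow tetrahedron. *)
Definition euler_eq (D : complex) : bool :=
  evens D + b0 (vert D) (edge D) + sphere D
  == odds D + only_empty D + b0 (vert (dual D)) (edge (dual D)).

(* The guards prune the enumeration of all [2 ^ 16] families to the complexes. *)
Lemma euler_check : all_bool (fun x =>
  all_bool (fun x0 => if x0 ==> x then all_bool (fun x1 => if x1 ==> x then
  all_bool (fun x2 => if x2 ==> x then all_bool (fun x3 => if x3 ==> x then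
  all_bool (fun x01 => if x01 ==> (x0 && x1) then
  all_bool (fun x02 => if x02 ==> (x0 && x2) then
  all_bool (fun x03 => if x03 ==> (x0 && x3) then
  all_bool (fun x12 => if x12 ==> (x1 && x2) then
  all_bool (fun x13 => if x13 ==> (x1 && x3) then
  all_bool (fun x23 => if x23 ==> (x2 && x3) then
  all_bool (fun x012 => if x012 ==> [&& x01, x02 & x12] then
  all_bool (fun x013 => if x013 ==> [&& x01, x03 & x13] then
  all_bool (fun x023 => if x023 ==> [&& x02, x03 & x23] then
  all_bool (fun x123 => if x123 ==> [&& x12, x13 & x23] then
  all_bool (fun x0123 => if x0123 ==> [&& x012, x013, x023 & x123] then
    euler_eq (ctbl x x0 x1 x2 x3 x01 x02 x03 x12 x13 x23
                x012 x013 x023 x123 x0123) else true)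
  else true) else true) else true) else true) else true) else true) else true)
  else true) else true) else true)
  else true) else true) else true) else true)).
Proof. by vm_compute. Qed.

(** The sixteen values of [D] are fed to [euler_check], each guard being an instance of closure
    under subsets. *)
Lemma euler_char (D : complex) : is_complex D -> euler_eq D.
Proof.
move=> C.
have {1}-> : D = ctbl (D false false false false)
  (D true false false false) (D false true false false)
  (D false false true false) (D false false false true)
  (D true true false false) (D true false true false) (D true false false true)
  (D false true true false) (D false true false true) (D false false true true)
  (D true true true false) (D true true false true) (D true false true true)
  (D false true true true) (D true true true true).
  by apply: funext=> [] []; apply: funext=> [] []; apply: funext=> [] [];
  apply: funext=> [] [].
have I (b b' : bool) : (b -> b') -> b ==> b' by case: b => // /(_ isT).
have C1 a b c d a' b' c' d' : (a' ==> a) && (b' ==> b) && (c' ==> c) && (d' ==> d) ->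
  D a b c d ==> D a' b' c' d' by move=> le; apply: I; apply: C.
have C2 (x y z : bool) : (x ==> y) -> (x ==> z) -> x ==> (y && z) by case: x; case: y.
move: euler_check.
move/all_boolP/(_ (D false false false false)).
move/all_boolP/(_ (D true false false false)); rewrite C1 //.
move/all_boolP/(_ (D false true false false)); rewrite C1 //.
move/all_boolP/(_ (D false false true false)); rewrite C1 //.
move/all_boolP/(_ (D false false false true)); rewrite C1 //.
move/all_boolP/(_ (D true true false false)); rewrite C2 ?C1 //.
move/all_boolP/(_ (D true false true false)); rewrite C2 ?C1 //.
move/all_boolP/(_ (D true false false true)); rewrite C2 ?C1 //.
move/all_boolP/(_ (D false true true false)); rewrite C2 ?C1 //.
move/all_boolP/(_ (D false true false true)); rewrite C2 ?C1 //.
move/all_boolP/(_ (D false false true true)); rewrite C2 ?C1 //.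
move/all_boolP/(_ (D true true true false)); rewrite !C2 ?C1 //.
move/all_boolP/(_ (D true true false true)); rewrite !C2 ?C1 //.
move/all_boolP/(_ (D true false true true)); rewrite !C2 ?C1 //.
move/all_boolP/(_ (D false true true true)); rewrite !C2 ?C1 //.
by move/all_boolP/(_ (D true true true true)); rewrite !C2 ?C1.
Qed.

Definition gluing_chk (v : pred nat) (e : rel nat) (q : pred nat) : bool :=
  b0 (fun i => v i || q i) e == b0 v e + count q (iota 0 4).

(** The guards are the hypotheses of [b0_isolated], read on tables. *)
Lemma gluing_check :
  all_bool (fun v0 => all_bool (fun v1 => all_bool (fun v2 => all_bool (fun v3 =>
  all_bool (fun q0 => if q0 ==> (~~ v0) then all_bool (fun q1 => if q1 ==> (~~ v1) then
  all_bool (fun q2 => if q2 ==> (~~ v2) then all_bool (fun q3 => if q3 ==> (~~ v3) then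
  if [|| q0, q1, q2 | q3] ==> [|| v0, v1, v2 | v3] then
  all_bool (fun e01 => if e01 ==> (v0 && v1) then
  all_bool (fun e02 => if e02 ==> (v0 && v2) then
  all_bool (fun e03 => if e03 ==> (v0 && v3) then
  all_bool (fun e12 => if e12 ==> (v1 && v2) then
  all_bool (fun e13 => if e13 ==> (v1 && v3) then
  all_bool (fun e23 => if e23 ==> (v2 && v3) then
    gluing_chk (vtbl v0 v1 v2 v3) (etbl e01 e02 e03 e12 e13 e23)
      (vtbl q0 q1 q2 q3) else true)
  else true) else true) else true) else true) else true) else true else true)
  else true) else true)
  else true))))).
Proof. by vm_compute. Qed.

Lemma vtblE (v : pred nat) i : i < 4 -> v i = vtbl (v 0) (v 1) (v 2) (v 3) i.
Proof. by case: i => [|[|[|[|i]]]]. Qed.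

(** An isolated new vertex is a new component. An old vertex must exist, since the first vertex
    added to an empty graph leaves [b0] at 0. *)
Lemma b0_isolated (v : pred nat) (e : rel nat) (q : pred nat) :
  graph4 e -> (forall i, i < 4 -> q i -> ~~ v i) ->
  (forall i, i < 4 -> q i -> exists2 j, j < 4 & v j) ->
  (forall i j, i < 4 -> j < 4 -> e i j -> v i && v j) ->
  b0 (fun i => v i || q i) e = b0 v e + count q (iota 0 4).
Proof.
move=> G qv qne ev; have E := fun k l => @etblE e k l G.
rewrite (eq_b0 (v' := fun i => vtbl (v 0) (v 1) (v 2) (v 3) i
  || vtbl (q 0) (q 1) (q 2) (q 3) i) _ E); last first.
  by move=> i i4; rewrite (vtblE v) // (vtblE q).
rewrite (eq_b0 (v' := vtbl (v 0) (v 1) (v 2) (v 3)) _ E); last exact: vtblE.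
have I (b b' : bool) : (b -> b') -> b ==> b' by case: b => // /(_ isT).
move: gluing_check.
move/all_boolP/(_ (v 0))/all_boolP/(_ (v 1))/all_boolP/(_ (v 2))/all_boolP/(_ (v 3)).
move/all_boolP/(_ (q 0)); rewrite I; last exact: qv.
move/all_boolP/(_ (q 1)); rewrite I; last exact: qv.
move/all_boolP/(_ (q 2)); rewrite I; last exact: qv.
move/all_boolP/(_ (q 3)); rewrite I; last exact: qv.
rewrite I; last first.
  have V i : i < 4 -> q i -> [|| v 0, v 1, v 2 | v 3].
    by move=> i4 /(qne i i4)[[|[|[|[|j]]]]] // _ ->; rewrite ?orbT.
  by case/or4P; apply: V.
move/all_boolP/(_ (e 0 1)); rewrite I; last exact: ev.
move/all_boolP/(_ (e 0 2)); rewrite I; last exact: ev.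
move/all_boolP/(_ (e 0 3)); rewrite I; last exact: ev.
move/all_boolP/(_ (e 1 2)); rewrite I; last exact: ev.
move/all_boolP/(_ (e 1 3)); rewrite I; last exact: ev.
move/all_boolP/(_ (e 2 3)); rewrite I; last exact: ev.
by move/eqP.
Qed.

Local Open Scope classical_set_scope.
Local Open Scope ring_scope.

(** * Counting components of squarefree divisor complexes *)

(* [h] stands for membership in [H], [p] for membership in [PF' H], and [F] for
   the Frobenius number. *)
Section Semigroup4.
Variables (h p : int -> bool) (F : nat) (nn : nat -> nat).
Definition wt (a b c d : bool) : nat := (a * nn 0 + b * nn 1 + c * nn 2 + d * nn 3)%N.
Definition divisor_complex (g : int) : complex := fun a b c d => h (g - (wt a b c d)%:Z).
(** By [dualE], this is the Alexander dual of [divisor_complex] in degree [top_degree - g]. *)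
Definition pf_complex (g : int) : complex := fun a b c d =>
  h (g - (wt a b c d)%:Z) || p (g - (wt a b c d)%:Z).
(** Alexander duality exchanges the degrees [g] and [top_degree - g]. Beyond this degree every
    [divisor_complex] is the full simplex, so the sums over degrees stop here. *)
Definition top_degree : nat := (F + wt true true true true)%N.

Lemma vertD g i : (i < 4)%N -> vert (divisor_complex g) i = h (g - (nn i)%:Z).
Proof.
by case: i => [|[|[|[|i]]]] // _; rewrite /vert /divisor_complex /wt /=; congr (h _); lia.
Qed.

Lemma vertE g i : (i < 4)%N ->
  vert (pf_complex g) i = h (g - (nn i)%:Z) || p (g - (nn i)%:Z).
Proof.
by case: i => [|[|[|[|i]]]] // _; rewrite /vert /pf_complex /wt /=; congr (h _ || p _); lia.
Qed.

Lemma edgeD g i j : (i < 4)%N -> (j < 4)%N ->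
  edge (divisor_complex g) i j = (i != j) && h (g - (nn i)%:Z - (nn j)%:Z).
Proof.
by case: i => [|[|[|[|i]]]] //; case: j => [|[|[|[|j]]]] // _ _;
  rewrite /edge /divisor_complex /wt //=; congr (h _); lia.
Qed.

Lemma edgeE g i j : (i < 4)%N -> (j < 4)%N -> edge (pf_complex g) i j =
  (i != j) && (h (g - (nn i)%:Z - (nn j)%:Z) || p (g - (nn i)%:Z - (nn j)%:Z)).
Proof.
by case: i => [|[|[|[|i]]]] //; case: j => [|[|[|[|j]]]] // _ _;
  rewrite /edge /pf_complex /wt //=; congr (h _ || p _); lia.
Qed.

Lemma edge_graph4 (D : complex) : graph4 (edge D).
Proof.
split=> [i|i j]; first by rewrite /edge eqxx.
by rewrite /edge eq_sym; case: ifP => // _; rewrite !(orbC (i == _)).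
Qed.

Hypothesis n_gt0 : forall i, (i < 4)%N -> (0 < nn i)%N.
Hypothesis h0 : h 0.
Hypothesis hD : forall x y, h x -> h y -> h (x + y).
Hypothesis h_ge0 : forall x, h x -> 0 <= x.
Hypothesis hn : forall i, (i < 4)%N -> h (nn i)%:Z.
Hypothesis h_big : forall x, F%:Z < x -> h x.
Hypothesis h_gen : forall x, h x -> x = 0 \/ exists2 i, (i < 4)%N & h (x - (nn i)%:Z).
Hypothesis h_sym : forall x, ~~ h x = h (F%:Z - x) || p (F%:Z - x).
Hypothesis p_range : forall x, p x -> 0 < x < F%:Z.
Hypothesis p_notin : forall x, p x -> ~~ h x.
Hypothesis pfE : forall x, p x || (x == F%:Z) =
  ~~ h x && all (fun i => h (x + (nn i)%:Z)) (iota 0 4).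

Lemma h_nn i x : (i < 4)%N -> h x -> h (x + (nn i)%:Z).
Proof. by move=> i4 hx; apply: hD => //; apply: hn. Qed.

Lemma h_muln i k : (i < 4)%N -> h ((k * nn i)%N)%:Z.
Proof.
move=> i4; elim: k => [|k IH]; first by rewrite mul0n.
by rewrite mulSn addnC PoszD h_nn.
Qed.

Lemma h_wt a b c d : h (wt a b c d)%:Z.
Proof. by rewrite /wt !PoszD !hD ?h_muln. Qed.

Lemma divisor_complexP g : is_complex (divisor_complex g).
Proof.
move=> a b c d a' b' c' d' le hD0.
have -> : divisor_complex g a' b' c' d' = h (g - (wt a b c d)%:Z +
  (wt (a && ~~ a') (b && ~~ b') (c && ~~ c') (d && ~~ d'))%:Z).
  rewrite /divisor_complex; congr (h _); rewrite /wt.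
  case: a a' b b' c c' d d' le {hD0}=> [] [] // [] [] // [] [] // [] [] //= _; lia.
by apply: hD => //; apply: h_wt.
Qed.

Lemma p_add i x : (i < 4)%N -> p x -> h (x + (nn i)%:Z).
Proof.
move=> i4 px; have := pfE x; rewrite px orTb => /esym/andP[_ /allP H]; apply: H.
by rewrite mem_iota.
Qed.

(** A generator added to an element of [H] or of [PF'] gives an element of [H]. Hence the new edges
    join old vertices, and the vertices of [divisor_complex] with the edges of [pf_complex] form a
    graph. *)
Lemma edgeE_vert g i j : (i < 4)%N -> (j < 4)%N -> edge (pf_complex g) i j ->
  vert (divisor_complex g) i && vert (divisor_complex g) j.
Proof.
move=> i4 j4; rewrite edgeE // !vertD // => /andP[_ hp].
have S k x : (k < 4)%N -> h x || p x -> h (x + (nn k)%:Z).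
  by move=> k4 /orP[/h_nn|/p_add]; apply.
have := S j _ j4 hp; have := S i _ i4 hp; rewrite subrK => h1 ->.
by move: h1; rewrite addrAC subrK => ->.
Qed.

Lemma b0_pf_complex g : b0 (vert (pf_complex g)) (edge (pf_complex g)) =
  (b0 (vert (divisor_complex g)) (edge (pf_complex g)) 
   + count (fun i => p (g - (nn i)%:Z)) (iota 0 4))%N.
Proof.
rewrite -b0_isolated.
- by apply: eq_b0 => // i i4; rewrite vertE // vertD.
- exact: edge_graph4.
- by move=> i i4 /p_notin; rewrite vertD.
(* A new vertex [i] puts [g] in [H], and [g] is not 0 because [g - nn i] is positive; so some
   generator can be subtracted from [g] within [H], which is an old vertex. *)
- move=> i i4 pi; have := p_add i4 pi; rewrite subrK => hg.
  case: (h_gen hg) => [g0|[j j4 hj]]; last by exists j; rewrite ?vertD.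
  by move/p_range: pi; rewrite g0; lia.
- by move=> i j; apply: edgeE_vert.
Qed.

Lemma only_emptyE (g : nat) : only_empty (divisor_complex g%:Z) = (g == 0)%N.
Proof.
rewrite /only_empty {1}/divisor_complex.
have -> : wt false false false false = 0%N by rewrite /wt; lia.
rewrite subr0; apply/idP/eqP => [/andP[hg /hasPn nv]|->].
  case: (h_gen hg) => [|[i i4 hi]]; first by case.
  by have := nv i; rewrite mem_iota vertD // hi => /(_ i4).
rewrite h0 andTb; apply/hasPn => i; rewrite mem_iota => i4; rewrite vertD //.
by apply/negP => /h_ge0; have := n_gt0 i4; lia.
Qed.

(** Put x = g - N with N the sum of the generators. The missing tetrahedron says that x is not in
    [H], the four triangles that each x + n_i is: x is pseudo-Frobenius. *)
Lemma sphereE (g : int) : sphere (divisor_complex g) =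
  p (g - (wt true true true true)%:Z) || (g - (wt true true true true)%:Z == F%:Z).
Proof.
rewrite pfE /sphere /divisor_complex /= andbT.
congr [&& _, h _, h _, h _ & h _]; rewrite /wt; lia.
Qed.

(** The complement of a face S has weight N - n_S, so reflecting g - (N - n_S) at F, as in [h_sym],
    gives F + N - g - n_S. *)
Lemma dualE g a b c d :
  dual (divisor_complex g) a b c d = pf_complex (top_degree%:Z - g) a b c d.
Proof.
rewrite /dual /divisor_complex h_sym /pf_complex.
have -> : F%:Z - (g - (wt (~~ a) (~~ b) (~~ c) (~~ d))%:Z) =
    top_degree%:Z - g - (wt a b c d)%:Z.
  by rewrite /top_degree /wt; case: a b c d => [] [] [] [] /=; lia.
by [].
Qed.

(** Since [a] is at most the sum of the generators, the shift of [0, F] by [a] stays within [0,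
    [top_degree]]. *)
Lemma sum_shift (P : int -> bool) a : (forall x, P x -> 0 <= x <= F%:Z) ->
  (a <= wt true true true true)%N ->
  (\sum_(0 <= g < top_degree.+1) P (g%:Z - a%:Z)%R = \sum_(0 <= x < F.+1) P x%:Z)%N.
Proof.
move=> PF aN; rewrite (@big_cat_nat _ _ _ a) //=; last by rewrite /top_degree; lia.
rewrite big_nat_cond big1 ?add0n; last first.
  move=> g; rewrite andbT => /andP[_ ga].
  by case: (P _) (PF (g%:Z - a%:Z)%R) => // /(_ isT); lia.
rewrite (@big_cat_nat _ _ _ (F.+1 + a)%N) //=; [|lia|rewrite /top_degree; lia].
rewrite addnC big_nat_cond big1 ?add0n; last first.
  move=> g; rewrite andbT => /andP[Fg _].
  by case: (P _) (PF (g%:Z - a%:Z)%R) => // /(_ isT); lia.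
rewrite -{1}(add0n a) big_addn addnK; apply: eq_big_nat => g _.
by congr (nat_of_bool (P _)); lia.
Qed.

Local Notation M := top_degree.
Local Notation b0D g := (b0 (vert (divisor_complex g%:Z)) (edge (divisor_complex g%:Z))).
Local Notation b0DE g := (b0 (vert (divisor_complex g%:Z)) (edge (pf_complex g%:Z))).
Local Notation b0E g := (b0 (vert (pf_complex g%:Z)) (edge (pf_complex g%:Z))).
Local Notation b0V g :=
  (b0 (vert (dual (divisor_complex g%:Z))) (edge (dual (divisor_complex g%:Z)))).

Let G := (\sum_(0 <= x < F.+1) ~~ h x%:Z)%N.
(** The type of [H] minus one. *)
Let tau := (\sum_(0 <= x < F.+1) p x%:Z)%N.

(** For each degree g, exactly one of three holds: g - a is in [H], is a gap, or is negative. *)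
Lemma sum_h a : (a <= wt true true true true)%N ->
  (\sum_(0 <= g < M.+1) h (g%:Z - a%:Z)%R + G + a = top_degree.+1)%N.
Proof.
move=> aN; pose L (x : int) := (0 <= x) && ~~ h x.
have -> : G = (\sum_(0 <= g < M.+1) L (g%:Z - a%:Z)%R)%N.
  rewrite (sum_shift _ aN); first by apply: eq_bigr.
  by move=> x /andP[-> /(contra (@h_big x))]; lia.
have aE : a = (\sum_(0 <= g < M.+1) (g < a))%N.
  rewrite (@big_cat_nat _ _ _ a) //=; last by rewrite /top_degree; lia.
  rewrite [X in _ = (_ + X)%N]big_nat_cond [X in _ = (_ + X)%N]big1 ?addn0; last first.
    by move=> i; rewrite andbT => /andP[]; lia.
  under eq_big_nat => i /andP[_ ->] do [].
  by rewrite sum_nat_const_nat; lia.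
rewrite [X in (_ + X)%N]aE -!big_split /= -[RHS]subn0 -[RHS]muln1 -sum_nat_const_nat.
apply: eq_bigr => g _; rewrite /L; have := @h_ge0 (g%:Z - a%:Z).
by case: (h _) => [/(_ isT)|_] /=; lia.
Qed.

(** By [sum_h] the number of degrees in which S is a face depends only on n_S, and linearly. Each
    generator lies in four even and four odd sets S, so the totals agree. *)
Lemma sum_euler : (\sum_(0 <= g < M.+1) evens (divisor_complex g%:Z)
  = \sum_(0 <= g < M.+1) odds (divisor_complex g%:Z))%N.
Proof.
rewrite /evens /odds !big_split /= /divisor_complex.
have S a b c d :
    (\sum_(0 <= g < M.+1) h (g%:Z - (wt a b c d)%:Z)%R + G + wt a b c d
    = M.+1)%N.
  by apply: sum_h; rewrite /wt; case: a b c d => [] [] [] [] /=; lia.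
move: (S false false false false) (S true false false false) (S false true false false)
 (S false false true false) (S false false false true)
 (S true true false false) (S true false true false) (S true false false true)
 (S false true true false) (S false true false true) (S false false true true)
 (S true true true false) (S true true false true) (S true false true true)
 (S false true true true) (S true true true true).
(* Only the additive occurrences of [wt] are unfolded; those under the sums stay folded, as parts of
   atoms for [lia]. *)
rewrite {2 4 6 8 10 12 14 16 18 20 22 24 26 28 30 32}/wt; lia.
Qed.

Lemma sum_only_empty :
  (\sum_(0 <= g < M.+1) only_empty (divisor_complex g%:Z))%N = 1%N.
Proof.
under eq_bigr do rewrite only_emptyE.
by rewrite big_nat_recl // big1.
Qed.

Lemma sum_sphere :
  (\sum_(0 <= g < M.+1) sphere (divisor_complex g%:Z))%N = tau.+1.
Proof.
under eq_bigr do rewrite sphereE.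
rewrite (@sum_shift (fun x => p x || (x == F%:Z))) //; last first.
  by move=> x /orP[/p_range|/eqP]; lia.
rewrite /tau !big_nat_recr //= eqxx orbT.
have -> : p F%:Z = false by apply/negP => /p_range; lia.
rewrite addn0 addn1; congr _.+1; apply: eq_big_nat => x xF.
by rewrite (_ : _ == _ = false) ?orbF //; lia.
Qed.

Lemma sum_isolated :
  (\sum_(0 <= g < M.+1) count (fun i => p (g%:Z - (nn i)%:Z)%R) (iota 0 4) = 4 * tau)%N.
Proof.
rewrite /= !big_split /= big1_eq.
have S i : (i < 4)%N -> (\sum_(0 <= g < M.+1) p (g%:Z - (nn i)%:Z)%R = tau)%N.
  move=> i4; apply: sum_shift => [x /p_range|]; first lia.
  by case: i i4 => [|[|[|[|i]]]] // _; rewrite /wt; lia.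
by rewrite !S //; lia.
Qed.

(** Summing [euler_eq] leaves b0 of the D_g plus [tau + 1] equal to 1 plus b0 of the duals. The
    duals, reindexed by g -> M - g, are the [pf_complex]es, whose isolated vertices contribute
    [4 * tau]. *)
Lemma sum_b0 : (\sum_(0 <= g < M.+1) b0D g
  = \sum_(0 <= g < M.+1) b0DE g + 3 * tau)%N.
Proof.
have D : (\sum_(0 <= g < M.+1) b0V g
  = \sum_(0 <= g < M.+1) b0E g)%N.
  rewrite [RHS]big_nat_rev /=; apply: eq_big_nat => g gt.
  have -> : dual (divisor_complex g%:Z) = pf_complex (top_degree%:Z - g%:Z).
    by do 4![apply: funext => ?]; rewrite dualE.
  by have -> : top_degree%:Z - g%:Z = (0 + top_degree.+1 - g.+1)%N%:Z by lia.
have E : (\sum_(0 <= g < M.+1)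
    (evens (divisor_complex g%:Z) + b0D g + sphere (divisor_complex g%:Z))
  = \sum_(0 <= g < M.+1) (odds (divisor_complex g%:Z)
      + only_empty (divisor_complex g%:Z) + b0V g))%N.
  by apply: eq_bigr => g _; apply/eqP/euler_char/divisor_complexP.
have S3 (f1 f2 f3 : nat -> nat) : (\sum_(0 <= g < M.+1) (f1 g + f2 g + f3 g) =
  \sum_(0 <= g < M.+1) f1 g + \sum_(0 <= g < M.+1) f2 g
  + \sum_(0 <= g < M.+1) f3 g)%N.
  by rewrite !big_split.
have B : (\sum_(0 <= g < M.+1) b0E g =
  \sum_(0 <= g < M.+1) b0DE g + 4 * tau)%N.
  by rewrite -sum_isolated -big_split; apply: eq_bigr => g _; apply: b0_pf_complex.
move: E; rewrite [LHS]S3 [RHS]S3 D B sum_only_empty sum_sphere sum_euler; lia.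
Qed.

Lemma b0_pf_complex_eq0 (g : nat) :
  (\sum_(0 <= g < M.+1) b0D g <= 3 * tau)%N ->
  b0DE g = 0%N.
Proof.
rewrite sum_b0 => le; case: (leqP g top_degree) => gt.
  have : (\sum_(0 <= g < M.+1) b0DE g)%N == 0%N by lia.
  rewrite sum_nat_seq_eq0 => /allP/(_ g); rewrite mem_index_iota => /(_ gt).
  by move/eqP.
(* Degrees above [top_degree] are outside the sum; there all four vertices are present and pairwise
   joined. *)
have full a b c d : divisor_complex g%:Z a b c d.
  by apply: h_big; move: gt; rewrite /top_degree /wt; case: a b c d => [] [] [] [] /=; lia.
rewrite (@eq_b0 _ xpredT _ (fun i j => i != j)) // => [i _|k l _ _]; first exact: full.
by rewrite /edge; case: eqP => // _; have := full; rewrite /divisor_complex /pf_complex => ->.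
Qed.
End Semigroup4.

(** * Toric ideals *)

Section IdealGen.
Variables (K : fieldType) (e : nat).
Implicit Types (S : set {mpoly K[e]}) (p q : {mpoly K[e]}).

Lemma ideal_gen_mem S p : S p -> ideal_gen S p.
Proof. by move=> Sp; exists 1%N, (fun=> 1), (fun=> p); rewrite big_ord1 mul1r. Qed.

Lemma ideal_genM S p q : ideal_gen S p -> ideal_gen S (q * p).
Proof.
case=> k [c [s [Ss ->]]]; exists k, (fun i => q * c i), s; split => //.
by rewrite mulr_sumr; apply: eq_bigr => i _; rewrite mulrA.
Qed.

Lemma ideal_genD S p q : ideal_gen S p -> ideal_gen S q -> ideal_gen S (p + q).
Proof.
case=> k [c [s [Ss ->]]] [k' [c' [s' [Ss' ->]]]].
pose glue (f : 'I_k -> {mpoly K[e]}) f' (i : 'I_(k + k')) :=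
  match fintype.split i with inl j => f j | inr j => f' j end.
exists (k + k')%N, (glue c c'), (glue s s'); split=> [i|].
  by rewrite /glue; case: fintype.split.
rewrite big_split_ord /glue; congr (_ + _); apply: eq_bigr => i _.
  by rewrite (unsplitK (inl i)).
by rewrite (unsplitK (inr i)).
Qed.

Lemma ideal_gen0 S : ideal_gen S 0.
Proof. by exists 0%N, (fun=> 0), (fun=> 0); rewrite big_ord0; split=> // -[]. Qed.

Lemma ideal_genN S p : ideal_gen S p -> ideal_gen S (- p).
Proof. by move=> Sp; rewrite -mulN1r; apply: ideal_genM. Qed.

Lemma ideal_gen_sum S (I : Type) (r : seq I) (P : pred I) (f : I -> {mpoly K[e]}) :
  (forall i, P i -> ideal_gen S (f i)) -> ideal_gen S (\sum_(i <- r | P i) f i).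
Proof.
by move=> Sf; elim/big_ind: _ => [|p q|i /Sf//]; [apply: ideal_gen0|apply: ideal_genD].
Qed.
End IdealGen.

Section ToricIdeal.
Variables (K : fieldType) (e : nat) (n : 'I_e -> nat).
Implicit Types (p q : {mpoly K[e]}) (u v : 'X_{1..e}).

(** The degree of ['X_[u]] in the grading where the variable i has degree [n i]. *)
Definition mwt u : nat := (\sum_i u i * n i)%N.

Lemma mwtD u v : mwt (u + v)%MM = (mwt u + mwt v)%N.
Proof. by rewrite /mwt -big_split; apply: eq_bigr => i _; rewrite mnmDE mulnDl. Qed.

Lemma mwt1 i : mwt U_(i)%MM = n i.
Proof.
rewrite /mwt (bigD1 i) //= big1 => [|j ji]; first by rewrite mnm1E eqxx mul1n addn0.
by rewrite mnm1E eq_sym (negPf ji).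
Qed.

(* The substitution [x_i := t^(n i)] for [i] in [C] and [x_i := 0] otherwise;
   for the full [C] this is [param_map]. *)
Definition cparam (C : pred 'I_e) p : {poly K} :=
  mmap (@polyC K) (fun i => if C i then 'X^(n i) else 0) p.

HB.instance Definition _ C := GRing.RMorphism.copy (cparam C)
  (mmap (@polyC K) (fun i => if C i then 'X^(n i) else 0)).

Definition supported (C : pred 'I_e) u : bool := [forall i, (u i != 0)%N ==> C i].

Lemma cparamX C u : cparam C 'X_[u] = if supported C u then 'X^(mwt u) else 0.
Proof.
rewrite /cparam mmapX /mmap1; case: ifP => [/forallP su|/negbT].
  rewrite /mwt expr_sum /=; apply: eq_bigr => i _; have := su i.
  by case: (u i) => [|k] /=; rewrite ?expr0 ?mul0n ?expr0 // => ->; rewrite mulnC exprM.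
rewrite negb_forall => /existsP[i]; rewrite negb_imply => /andP[ui /negPf Ci].
by rewrite (bigD1 i) //= Ci expr0n (negPf ui) mul0r.
Qed.

Lemma param_mapE p : param_map n p = cparam predT p.
Proof. by []. Qed.

Lemma param_mapX u : param_map n ('X_[u] : {mpoly K[e]}) = 'X^(mwt u).
Proof. by rewrite param_mapE cparamX ifT //; apply/forallP => i; rewrite implybT. Qed.

Lemma cparamE C p : cparam C p = \sum_(u <- msupp p) p@_u *: cparam C 'X_[u].
Proof.
rewrite {1}[p]mpolyE raddf_sum /=; apply: eq_bigr => u _.
by rewrite /cparam mmapZ mul_polyC.
Qed.

Lemma cparam_coef C d p : (forall u, mwt u = d -> supported C u) ->
  (cparam C p)`_d = (param_map n p)`_d.
Proof.
move=> dC; rewrite param_mapE !cparamE !coef_sum; apply: eq_bigr => u _.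
rewrite !coefZ -param_mapE param_mapX cparamX; congr (_ * _).
case: ifP => // /negP nC; rewrite coef0 coefXn.
by case: eqP => // du; case: nC; apply: dC.
Qed.

(** No monomial of degree [d] mixes variables inside and outside [C]: among the vertices of D_d, [C]
    cuts out a union of components. *)
Definition separates (d : nat) (C : pred 'I_e) : Prop :=
  forall u i, mwt u = d -> C i -> u i != 0%N -> supported C u.

(** If [i] is outside [C], the substitution kills the product. Otherwise all monomials of degree
    [d - n i] are supported in [C], so the coefficient is one of [param_map n q], which is 0. *)
Lemma cparam_toricX d C i q : separates d C -> toric_ideal K n q ->
  (cparam C ('X_i * q))`_d = 0.
Proof.
move=> sep Iq; rewrite rmorphM /= /cparam mmapX mmap1U -/(cparam C q).
case: ifPn => [Ci|_]; last by rewrite mul0r coef0.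
rewrite coefXnM; case: ltnP => // nd; rewrite cparam_coef ?Iq ?coef0 // => u du.
have /forallP su : supported C (U_(i) + u)%MM.
  apply: (sep _ i) => //; first by rewrite mwtD mwt1 du subnKC.
  by rewrite mnmDE mnm1E eqxx.
apply/forallP => j; apply/implyP => uj; have /implyP := su j; apply.
by rewrite mnmDE addn_eq0 negb_and uj orbT.
Qed.

Lemma toric_idealM p q : toric_ideal K n q -> toric_ideal K n (p * q).
Proof.
by rewrite /toric_ideal /= => Iq; rewrite !param_mapE rmorphM /= -!param_mapE Iq mulr0.
Qed.

(** Nonconstant monomials of [p] contain a variable and contribute nothing by [cparam_toricX]. So
    the coefficient is a linear functional on I_H modulo the maximal ideal times I_H. *)
Lemma cparam_toricM d C p q : separates d C -> toric_ideal K n q ->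
  (cparam C (p * q))`_d = p@_0%MM * (cparam C q)`_d.
Proof.
move=> sep Iq; rewrite {1 2}[p]mpolyE mulr_suml raddf_sum /= coef_sum.
rewrite raddf_sum /= mulr_suml; apply: eq_bigr => u _.
rewrite -scalerAl mcoeffZ mcoeffX {1}/cparam mmapZ -/(cparam C _).
rewrite coefCM -mulrA; congr (_ * _).
case: eqP => [->|/eqP u0]; first by rewrite mpolyX0 mul1r mul1r.
rewrite mul0r; have [i ui] : exists i, u i != 0%N.
  apply/existsP; apply: contraR u0 => /existsPn u0; apply/eqP/mnmP => i.
  by rewrite mnm0E; apply/eqP; rewrite -[_ == _]negbK u0.
have -> : u = (U_(i) + (u - U_(i)))%MM.
  apply/mnmP => j; rewrite mnmDE mnmBE mnm1E; case: eqP => [<-|_] /=; move: ui; lia.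
by rewrite mpolyXD -mulrA cparam_toricX //; apply: toric_idealM.
Qed.

(** The functionals take the [b s] to the unit vectors, while their values are spanned by those on
    the [m] generators; the matrix [M] of the latter thus has rank [#|T|]. *)
Lemma generators_ge (T : finType) (d : T -> nat) (C : T -> pred 'I_e)
    (b : T -> {mpoly K[e]}) (m : nat) :
  (forall s, separates (d s) (C s)) ->
  (forall s, toric_ideal K n (b s)) ->
  (forall s s', (cparam (C s) (b s'))`_(d s) = (s == s')%:R) ->
  generated_by (toric_ideal K n) m -> (#|T| <= m)%N.
Proof.
move=> sep Ib bd [g gI].
have Ig i : toric_ideal K n (g i) by rewrite -gI; apply: ideal_gen_mem; exists i.
pose M := \matrix_(i < m, j < #|T|) (cparam (C (enum_val j)) (g i))`_(d (enum_val j)).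
have rowM s : exists w : 'rV[K]_m, w *m M = \row_j (enum_val j == s)%:R.
  have : ideal_gen (range g) (b s) by rewrite gI.
  case=> k [c [a [ga bE]]].
  have /choice[r ra] : forall i, exists j, g j = a i.
    by move=> i; case: (ga i) => j _; exists j.
  (* Only the constant terms of the coefficients survive, by [cparam_toricM]. *)
  exists (\sum_(i < k) (c i)@_0%MM *: delta_mx 0 (r i)).
  apply/rowP => j; rewrite [RHS]mxE -bd bE raddf_sum coef_sum mulmx_suml summxE.
  apply: eq_bigr => i _; rewrite -scalemxAl -rowE !mxE cparam_toricM // -ra //.
have /choice[w wM] := rowM.
have <- : \rank (1%:M : 'M[K]_#|T|) = #|T| by rewrite mxrank1.
have -> : 1%:M = (\matrix_i w (enum_val i)) *m M.
  apply/row_matrixP => i; rewrite row_mul rowK wM; apply/rowP => j.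
  by rewrite !mxE (inj_eq enum_val_inj) eq_sym.
exact: leq_trans (mxrankM_maxr _ _) (rank_leq_row _).
Qed.

(** Pick a monomial [r d] in each degree [d] that has one. Replacing each monomial of [p] by the
    chosen one of its degree gives [psi (param_map n p) = 0], so [p] is a combination of differences
    of monomials of equal degree. *)
Lemma toric_sub_ideal_gen (S : set {mpoly K[e]}) :
  (forall u v, mwt u = mwt v -> ideal_gen S ('X_[u] - 'X_[v])) ->
  forall p, toric_ideal K n p -> ideal_gen S p.
Proof.
move=> Sb p Ip.
have /choice[r rP] : forall d, exists u, (exists v, mwt v = d) -> mwt u = d.
  move=> d; case: (pselect (exists v, mwt v = d)) => [[v vd]|]; first by exists v.
  by exists 0%MM.
have rE u : mwt (r (mwt u)) = mwt u by apply: rP; exists u.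
pose B := (\max_(u <- msupp p) mwt u).+1.
pose psi (f : {poly K}) : {mpoly K[e]} := \sum_(i < B) f`_i *: 'X_[r i].
have : psi (param_map n p) = 0.
  by rewrite Ip /psi big1 // => i _; rewrite coef0 scale0r.
have -> : psi (param_map n p) = \sum_(u <- msupp p) p@_u *: 'X_[r (mwt u)].
  rewrite /psi param_mapE cparamE.
  under eq_bigr => i _ do rewrite coef_sum scaler_suml.
  rewrite exchange_big /=; apply: eq_big_seq => u up.
  have uB : (mwt u < B)%N by rewrite /B ltnS; apply: leq_bigmax_seq.
  rewrite (bigD1 (Ordinal uB)) //= big1 ?addr0 => [|i iu].
    by rewrite -param_mapE param_mapX coefZ coefXn eqxx mulr1.
  rewrite -param_mapE param_mapX coefZ coefXn.
  rewrite (_ : (_ == _) = false) ?mulr0 ?scale0r //; apply/negbTE.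
  by apply: contra iu => /eqP iu; apply/eqP/val_inj.
move=> psi0; rewrite [p]mpolyE -[X in ideal_gen S X]subr0.
rewrite -[X in ideal_gen S (_ - X)]psi0 -sumrB.
apply: ideal_gen_sum => u _; rewrite -scalerBr -mul_mpolyC; apply: ideal_genM.
exact: Sb.
Qed.
End ToricIdeal.

(** * Pseudo-Frobenius numbers *)

Lemma card_of_seq (T : choiceType) (A : set T) (s : seq T) :
  uniq s -> (forall x, A x <-> x \in s) -> card_of A = size s.
Proof.
move=> us As; have AE : A = [set` s].
  by apply/predeqP => x; apply: As.
rewrite /card_of AE; apply/perm_size/uniq_perm => // x.
rewrite in_fset_set; last exact: finite_seq.
by apply/idP/idP => [/set_mem|xs]; last exact/mem_set.
Qed.

Lemma bigmax_mem (s : seq nat) : s != [::] -> (\max_(x <- s) x)%N \in s.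
Proof.
elim: s => // x [|y s] IH _; first by rewrite big_seq1 inE.
rewrite big_cons in_cons; case: leqP => _; last by rewrite eqxx.
by rewrite IH ?orbT.
Qed.

Section NumericalSemigroup.
Variables (e : nat) (n : 'I_e -> nat) (H : set nat).
Hypotheses (HS : numerical_semigroup H) (HG : minimally_generated n H).

Lemma semigroup_mwtP a : H a <-> exists u, mwt n u = a.
Proof.
case: HG => -> _; split=> [[c ->]|[u <-]]; last first.
  by exists u; apply: eq_bigl => i; rewrite inE.
exists [multinom c i | i < e]; apply: eq_big => [i|i _]; first by rewrite inE.
by rewrite mnmE.
Qed.

(** A zero generator could be dropped, against minimality. *)
Lemma generator_gt0 i : (0 < n i)%N.
Proof.
case: HG => HE Hmin; rewrite lt0n; apply/eqP => ni0.
apply: (Hmin ([set: 'I_e] :\ i)%SET); first by rewrite properD1 ?inE.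
rewrite HE; apply/predeqP => x; split=> -[c ->]; exists c.
  by rewrite [RHS](big_setD1 i) ?inE //= ni0 muln0.
by rewrite [LHS](big_setD1 i) ?inE //= ni0 muln0.
Qed.

Lemma generator_mem i : H (n i).
Proof. by apply/semigroup_mwtP; exists U_(i)%MM; rewrite mwt1. Qed.

Lemma frobenius_notin : ~ H (frobenius H).
Proof.
(* As [H] is not everything, the maximum is over a nonempty list and is not the default 0. *)
case: HS => _ _ fin HT; have : fset_set (~` H) != [::] :> seq nat.
  apply/eqP => HC0; apply: HT; apply/predeqP => x; split=> // _.
  apply: contrapT => Hx; have : x \in fset_set (~` H) by rewrite in_fset_set // inE.
  by rewrite -[x \in _]/(x \in enum_fset _) HC0.
by move/bigmax_mem; rewrite in_fset_set // inE.
Qed.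

Lemma gt_frobenius x : (frobenius H < x)%N -> H x.
Proof.
case: HS => _ _ fin _; apply: contraPP => Hx; apply/negP; rewrite -leqNgt.
by apply: (@leq_bigmax_seq _ _ xpredT id) => //; rewrite in_fset_set // inE.
Qed.

Definition mem_int (x : int) : bool := `[< int_set H x >].

Lemma mem_intP x : reflect (exists2 a, H a & a%:Z = x) (mem_int x).
Proof. exact: asboolP. Qed.

Lemma mem_int_nat (a : nat) : reflect (H a) (mem_int a%:Z).
Proof. by apply: (iffP (mem_intP _)) => [[b Hb [<-]]|] //; exists a. Qed.

Lemma mem_int0 : mem_int 0.
Proof. by apply/(mem_int_nat 0%N); case: HS. Qed.

Lemma mem_intD x y : mem_int x -> mem_int y -> mem_int (x + y).
Proof.
case/mem_intP=> a Ha <- /mem_intP[b Hb <-]; rewrite -PoszD; apply/mem_int_nat.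
by case: HS => _ HD _ _; apply: HD.
Qed.

Lemma mem_int_ge0 x : mem_int x -> 0 <= x.
Proof. by case/mem_intP=> a _ <-. Qed.

Lemma mem_int_generator i : mem_int (n i)%:Z.
Proof. exact/mem_int_nat/generator_mem. Qed.

Lemma mem_int_big x : (frobenius H)%:Z < x -> mem_int x.
Proof. by case: x => // x Fx; apply/mem_int_nat/gt_frobenius. Qed.

Lemma frobenius_nmem : ~~ mem_int (frobenius H)%:Z.
Proof. by apply/negP => /mem_int_nat/frobenius_notin. Qed.

Lemma mem_int_mwt x : mem_int x -> exists u, (mwt n u)%:Z = x.
Proof. by case/mem_intP=> a /semigroup_mwtP[u <-] <-; exists u. Qed.

Lemma mwt_mem_int u : mem_int (mwt n u)%:Z.
Proof. by apply/mem_int_nat/semigroup_mwtP; exists u. Qed.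

Lemma mwt_subU (u : 'X_{1..e}) i :
  u i != 0%N -> mwt n u = (mwt n (u - U_(i))%MM + n i)%N.
Proof.
move=> ui; rewrite -(mwt1 n i) -mwtD; congr mwt; apply/mnmP => j.
by rewrite mnmDE mnmBE mnm1E; case: eqP => [<-|_] /=; lia.
Qed.

Lemma mem_int_gen x : mem_int x -> x = 0 \/ exists i, mem_int (x - (n i)%:Z).
Proof.
case/mem_int_mwt=> u <-; case: (boolP [exists i, u i != 0%N]) => [/existsP[i ui]|u0].
  by right; exists i; rewrite (mwt_subU ui) PoszD addrK mwt_mem_int.
left; rewrite /mwt big1 // => i _; apply/eqP; rewrite muln_eq0.
by move/existsPn/(_ i): u0; rewrite negbK => ->.
Qed.

Lemma PF_P x : PF n H x <-> ~~ mem_int x /\ forall i, mem_int (x + (n i)%:Z).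
Proof.
split=> [[Hx Hn]|[/asboolPn Hx Hn]].
  by split=> [|i]; [apply/asboolPn; exact: Hx|apply/asboolP; exact: Hn].
by split=> [|i]; [|apply/mem_intP].
Qed.

Lemma PF_range x : PF n H x -> 0 < x <= (frobenius H)%:Z.
Proof.
case/PF_P=> Hx Hn; apply/andP; split; last first.
  by rewrite leNgt; apply: contra Hx; apply: mem_int_big.
rewrite lt_neqAle eq_sym (contraNneq _ Hx) /= => [|->]; last exact: mem_int0.
rewrite leNgt; apply/negP => x0.
(* For x < 0 the number F - x exceeds F, so it is n_i plus an element of [H]; with x + n_i in [H]
   this would put F in [H]. *)
have /mem_int_gen[|[i Hi]] : mem_int ((frobenius H)%:Z - x).
  by apply: mem_int_big; lia.
  by lia.
case/negP: frobenius_nmem.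
have -> : (frobenius H)%:Z = x + (n i)%:Z + ((frobenius H)%:Z - x - (n i)%:Z) by lia.
exact: mem_intD.
Qed.

Lemma frobenius_PF : PF n H (frobenius H)%:Z.
Proof.
apply/PF_P; split=> [|i]; first exact: frobenius_nmem.
by apply: mem_int_big; have := generator_gt0 i; lia.
Qed.

Definition pf' (x : int) : bool := `[< PF' n H x >].

Lemma pf'P x : reflect (PF n H x /\ x <> (frobenius H)%:Z) (pf' x).
Proof. exact: asboolP. Qed.

Lemma pf'_range x : pf' x -> 0 < x < (frobenius H)%:Z.
Proof. by case/pf'P=> /PF_range; lia. Qed.

Lemma pf'_nmem x : pf' x -> ~~ mem_int x.
Proof. by case/pf'P=> /PF_P[]. Qed.

Lemma card_int_range (A : set int) (b : int -> bool) m : (forall x, A x <-> b x) ->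
  (forall x, b x -> 0 <= x < m%:Z) ->
  card_of A = (\sum_(0 <= x < m) b x%:Z)%N.
Proof.
move=> Ab br; rewrite (@card_of_seq _ _ [seq Posz x | x <- iota 0 m & b x%:Z]).
- by rewrite size_map size_filter -sum1_count big_mkcond /index_iota subn0.
- by rewrite map_inj_uniq ?filter_uniq ?iota_uniq // => x y [].
- move=> x; rewrite Ab; split=> [bx|/mapP[y]]; last first.
    by rewrite mem_filter => /andP[? _] ->.
  have := br x bx; case: x bx => // x bx xm; apply: map_f.
  by rewrite mem_filter bx mem_iota; lia.
Qed.

Lemma sg_typeE : sg_type n H = (\sum_(0 <= x < (frobenius H).+1) pf' x%:Z).+1%N.
Proof.
rewrite /sg_type (@card_int_range _
  (fun x => pf' x || (x == (frobenius H)%:Z)) (frobenius H).+1).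
- rewrite !big_nat_recr //= eqxx orbT.
  have -> : pf' (frobenius H)%:Z = false by apply/negP => /pf'_range; lia.
  rewrite addn0 addn1; congr _.+1; apply: eq_big_nat => x xF.
  by rewrite (_ : _ == _ = false) ?orbF //; lia.
- move=> x; split=> [Px|/orP[/pf'P[]//|/eqP->]]; last exact: frobenius_PF.
  by case: eqP => [_|xF]; rewrite ?orbT // orbF; apply/pf'P.
- by move=> x /orP[/pf'_range|/eqP->]; lia.
Qed.

Lemma card_gapsE : card_of (~` H) = (\sum_(0 <= x < (frobenius H).+1) ~~ mem_int x%:Z)%N.
Proof.
rewrite (@card_of_seq _ _ [seq x <- iota 0 (frobenius H).+1 | ~~ mem_int x%:Z]).
- by rewrite size_filter -sum1_count big_mkcond /index_iota subn0.
- by rewrite filter_uniq ?iota_uniq.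
- move=> x; rewrite mem_filter mem_iota; split=> [Hx|/andP[/mem_int_nat//]].
  rewrite (introN (mem_int_nat x)) //= add0n ltnS leqNgt; apply/negP => /gt_frobenius.
  exact: Hx.
Qed.

(** Let [L] hold when neither x nor F - x is in [H]. Counting gaps, almost symmetry says that [L]
    has as many elements as [PF']; as [PF'] is contained in [L], they coincide, and [L] is invariant
    under x -> F - x. *)
Lemma almost_symmetricP : almost_symmetric n H -> forall x,
  ~~ mem_int x = mem_int ((frobenius H)%:Z - x) || pf' ((frobenius H)%:Z - x).
Proof.
rewrite /almost_symmetric sg_typeE card_gapsE; set F := frobenius H => AS.
pose L x := ~~ mem_int x && ~~ mem_int (F%:Z - x).
have HFx x : mem_int (F%:Z - x) -> ~~ mem_int x.
  by move=> Hx; apply: contra frobenius_nmem => /(mem_intD Hx); rewrite subrK.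
have pL x : pf' x -> L x.
  move=> px; rewrite /L pf'_nmem //=; case/pf'P: px => /PF_P[_ Hn] xF.
  apply: contra frobenius_nmem => Hx; case: (mem_int_gen Hx) => [|[i Hi]]; first lia.
  have -> : F%:Z = x + (n i)%:Z + (F%:Z - x - (n i)%:Z) by lia.
  exact: mem_intD.
have L_range x : L x -> 0 < x < F%:Z.
  case/andP=> nx nFx.
  have x0 : x <> 0 by move=> x0; rewrite x0 mem_int0 in nx.
  have xF : x <> F%:Z by move=> xF; rewrite xF subrr mem_int0 in nFx.
  move: (contra (@mem_int_big _) nx) (contra (@mem_int_big _) nFx); rewrite -/F; lia.
have sumL : (\sum_(0 <= x < F.+1) L x%:Z = \sum_(0 <= x < F.+1) pf' x%:Z)%N.
  have s1 : (\sum_(0 <= x < F.+1) ~~ mem_int x%:Z =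
     \sum_(0 <= x < F.+1) mem_int (F%:Z - x%:Z)%R + \sum_(0 <= x < F.+1) L x%:Z)%N.
    rewrite -big_split; apply: eq_bigr => x _; rewrite /L.
    by have := HFx x%:Z; case: (mem_int (_ - _)) => [->|]; case: (mem_int x).
  have s2 : (\sum_(0 <= x < F.+1) mem_int (F%:Z - x%:Z)%R =
      \sum_(0 <= x < F.+1) mem_int x%:Z)%N.
    rewrite [RHS]big_nat_rev /=; apply: eq_big_nat => x xF.
    by have -> : F%:Z - x%:Z = (0 + F.+1 - x.+1)%N%:Z by lia.
  have s3 : (\sum_(0 <= x < F.+1) mem_int x%:Z +
      \sum_(0 <= x < F.+1) ~~ mem_int x%:Z = F.+1)%N.
    rewrite -big_split /= -[RHS]subn0 -[RHS]muln1 -sum_nat_const_nat.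
    by apply: eq_bigr => x _; case: (mem_int x).
  lia.
have LE x : L x = pf' x.
  apply/idP/idP => [Lx|]; last exact: pL.
  apply: contraT => npx; have := L_range x Lx; case: x Lx npx => // x Lx npx xF.
  have : (\sum_(0 <= x < F.+1) (L x%:Z - pf' x%:Z) = 0)%N.
    rewrite sumnB; first by rewrite sumL subnn.
    by move=> i _; have := pL i%:Z; case: (pf' _) => // ->.
  move/eqP; rewrite sum_nat_seq_eq0 => /allP/(_ x); rewrite mem_index_iota Lx (negPf npx).
  by apply; rewrite ltnS; case/andP: xF => _ /ltW.
move=> x; rewrite -LE /L opprB addrCA subrr addr0.
by have := HFx x; case: (mem_int (_ - x)) => [->|] //=; rewrite andbT.
Qed.
End NumericalSemigroup.

(** * Row-factorization relations *)

Section RFRelations.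
Variables (K : fieldType) (e : nat) (n : 'I_e -> nat) (H : set nat).
Hypotheses (HS : numerical_semigroup H) (HG : minimally_generated n H).

(** Subtraction of multinomials is truncated: ['X_[u - v]] is ['X_[u]] divided by the gcd of the two
    monomials. *)
Lemma xpow_pos_part (r : 'rV[int]_e) (u v : 'X_{1..e}) :
  (forall l, r ord0 l = (u l)%:Z - (v l)%:Z) ->
  xpow K (pos_part r) = 'X_[u - v] /\ xpow K (neg_part r) = 'X_[v - u].
Proof.
move=> rE; split; congr 'X_[_]; apply/mnmP => l; rewrite mnmE mnmBE !mxE rE; lia.
Qed.

Lemma toric_binomial u v : mwt n u = mwt n v -> toric_ideal K n ('X_[u] - 'X_[v]).
Proof.
by move=> uv; rewrite /toric_ideal /= param_mapE rmorphB /= -!param_mapE !param_mapX uv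
  subrr.
Qed.

Lemma RF_relation_toric p : RF_relation K n H p -> toric_ideal K n p.
Proof.
case=> f _ [A [i [j [[_ _ Af] _ ->]]]]; apply: toric_binomial.
set r := row i A - row j A.
have rf : \sum_l r ord0 l * (n l)%:Z = 0.
  under eq_bigr => l _ do rewrite !mxE mulrBl.
  by rewrite sumrB !Af subrr.
apply/eqP; rewrite -eqz_nat -subr_eq0 -{}rf /mwt.
rewrite !(big_morph Posz PoszD (erefl 0)) -sumrB; apply/eqP/eq_bigr => l _.
rewrite !mnmE !PoszM -mulrBl; congr (_ * _); rewrite !mxE; lia.
Qed.

(* Two rows [a i], [a j] of a row-factorization matrix give the relation
   [x_j x^(a i) - x_i x^(a j)], up to a common monomial factor. *)
Lemma RF_connect f i j : pf' n H f -> i != j ->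
  exists u v : 'X_{1..e}, [/\ (mwt n u)%:Z = f + (n i)%:Z + (n j)%:Z,
    mwt n v = mwt n u, u j != 0%N, v i != 0%N
    & ideal_gen (RF_relation K n H) ('X_[u] - 'X_[v])].
Proof.
move=> pf ij; have [/PF_P[nf fn] _] := pf'P _ _ _ pf.
have /choice[a aE] : forall k, exists u, (mwt n u)%:Z = f + (n k)%:Z.
  (* The variable k cannot divide ['X_[a k]], since cancelling it would put [f] in [H]; this frees
     the diagonal for the entries -1. *)
  by move=> k; apply: (mem_int_mwt HG).
have a0 k : a k k = 0%N.
  apply/eqP; apply: contraNT nf => ak; have := aE k; rewrite (mwt_subU n ak) PoszD.
  by move/addIr => <-; apply: (mwt_mem_int HG).
pose A := \matrix_(k, l) (if k == l then -1 else (a k l)%:Z) : 'M[int]_e.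
have AE k l : A k l = (a k l)%:Z - (k == l)%:Z.
  by rewrite mxE; case: eqP => [<-|_]; rewrite ?a0 ?subr0 ?sub0r.
have ARF : is_RF_matrix n f A.
  split=> [k|k l kl|k]; first by rewrite mxE eqxx.
    by rewrite mxE (negPf kl).
  under eq_bigr => l _ do rewrite AE mulrBl.
  have delta : \sum_l (k == l)%:Z * (n l)%:Z = (n k)%:Z.
    rewrite (bigD1 k) //= eqxx mul1r big1 ?addr0 // => l.
    by rewrite eq_sym => /negPf ->; rewrite mul0r.
  rewrite sumrB delta; apply/eqP; rewrite subr_eq -aE /mwt.
  rewrite (big_morph Posz PoszD (erefl 0)); apply/eqP.
  by apply: eq_bigr => l _; rewrite PoszM.
pose u := (U_(j) + a i)%MM; pose v := (U_(i) + a j)%MM.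
have uvA l : (A i l) - A j l = (u l)%:Z - (v l)%:Z.
  rewrite !AE /u /v !mnmDE !mnm1E !PoszD; lia.
have rowB k k' l : (row k A - row k' A) ord0 l = A k l - A k' l by rewrite !mxE.
have split_uv (x y : 'X_{1..e}) : x = ((x - (x - y)) + (x - y))%MM.
  by apply/mnmP => l; rewrite mnmDE !mnmBE; lia.
have min_uv : (v - (v - u) = u - (u - v))%MM by apply/mnmP => l; rewrite !mnmBE; lia.
exists u, v; split.
- by rewrite /u mwtD mwt1 PoszD aE addrC.
- apply/eqP; rewrite -eqz_nat; apply/eqP; rewrite /u /v !mwtD !mwt1 !PoszD !aE; lia.
- by rewrite /u mnmDE mnm1E eqxx.
- by rewrite /v mnmDE mnm1E eqxx.
rewrite [X in 'X_[X] - _](split_uv u v) [X in _ - 'X_[X]](split_uv v u).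
rewrite min_uv !mpolyXD -mulrBr; apply: ideal_genM.
(* RF-relations use rows in increasing order; the other order changes the sign. *)
case: (ltngtP i j) => [lij|lji|/val_inj eij]; last by rewrite eij eqxx in ij.
  apply: ideal_gen_mem; exists f; first exact/asboolP; exists A, i, j; split=> //.
  by have [l|-> ->] := @xpow_pos_part (row i A - row j A) u v; rewrite ?rowB.
rewrite -opprB; apply/ideal_genN/ideal_gen_mem; exists f; first exact/asboolP.
exists A, j, i; split=> //.
have [l|-> -> //] := @xpow_pos_part (row j A - row i A) v u.
by rewrite rowB; have := uvA l; lia.
Qed.
End RFRelations.

(** * Four generators: components of D_g, minimal generators and connectedness *)

Section FourGenerators.
Variables (K : fieldType) (n : 'I_4 -> nat) (H : set nat).
Hypotheses (HS : numerical_semigroup H) (HG : minimally_generated n H)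
  (AS : almost_symmetric n H).

Let h := mem_int H.
Let p := pf' n H.
Let F := frobenius H.
Let nn k := n (inord k).
Let J := ideal_gen (RF_relation K n H).

Lemma nnE (i : 'I_4) : nn i = n i. Proof. by rewrite /nn inord_val. Qed.

Lemma h_gen4 x : h x -> x = 0 \/ exists2 i, (i < 4)%N & h (x - (nn i)%:Z).
Proof.
case/(mem_int_gen HG) => [|[i Hi]]; first by left.
by right; exists i => //; rewrite nnE.
Qed.

Lemma pfE4 x : p x || (x == F%:Z) =
  ~~ h x && all (fun i => h (x + (nn i)%:Z)) (iota 0 4).
Proof.
apply/idP/andP => [px|[Hx /allP Hn]].
  have [Hx Hn] : ~~ h x /\ forall i, h (x + (n i)%:Z).
    apply/PF_P; case/orP: px => [/pf'P[]//|/eqP->]; exact: frobenius_PF.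
  by split=> //; apply/allP => i _; apply: Hn.
case: eqP => [_|xF]; rewrite ?orbT // orbF; apply/pf'P; split => //.
apply/PF_P; split=> // i; rewrite -nnE; apply: Hn; rewrite mem_iota; exact: ltn_ord.
Qed.

Lemma mem_int_vertex x (i : nat) : h (x - (nn i)%:Z) ->
  exists u, (mwt n u)%:Z = x /\ u (inord i) != 0%N.
Proof.
case/(mem_int_mwt HG) => u ux; exists (U_(inord i) + u)%MM.
rewrite mwtD mwt1 PoszD ux -/(nn i) addrC subrK; split=> //.
by rewrite mnmDE mnm1E eqxx.
Qed.

Lemma mem_int_subU (u : 'X_{1..4}) (i : 'I_4) :
  u i != 0%N -> h ((mwt n u)%:Z - (n i)%:Z).
Proof. by move=> ui; rewrite (mwt_subU n ui) PoszD addrK; apply: mwt_mem_int. Qed.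

Lemma mem_int_subUU (u : 'X_{1..4}) (i j : 'I_4) : i != j -> u i != 0%N -> u j != 0%N ->
  h ((mwt n u)%:Z - (n i)%:Z - (n j)%:Z).
Proof.
move=> ij ui uj; rewrite (mwt_subU n ui) PoszD addrK; apply: mem_int_subU.
by rewrite mnmBE mnm1E (negPf ij) subn0.
Qed.

Let D (g : nat) := divisor_complex h nn g%:Z.
Let E (g : nat) := pf_complex h p nn g%:Z.
Let T4 := top_degree F nn.

Lemma rootP (d i : nat) : (i < 4)%N -> vert (D d) i ->
  exists r, [/\ (r < 4)%N, vert (D d) r & forall k, vert (D d) k -> (r <= k)%N].
Proof.
move=> i4 vi; have ex : exists r, vert (D d) r by exists i.
exists (ex_minn ex); case: ex_minnP => r vr rmin; split=> //.
exact: leq_ltn_trans (rmin _ vi) i4.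
Qed.

Section Generators.

(** A degree together with the least vertex of a component other than the first; the cardinality of
    [T] is the sum of all [b0]. *)
Let T := {s : 'I_T4.+1 * 'I_4 | nonroot (vert (D s.1)) (edge (D s.1)) s.2}.
Let C (s : T) : pred 'I_4 := fun j => conn (edge (D (val s).1)) (val s).2 j.

(** Two variables dividing one monomial of degree d span an edge of D_d, and a component is closed
    under edges. *)
Lemma conn_separates (s : T) : separates n (val s).1 (C s).
Proof.
move=> u i du Ci ui; apply/forallP => j; apply/implyP => uj.
case: (eqVneq i j) => [<-//|ij].
have [_] := conn_sym_closed (edge_graph4 (D (val s).1)) (ltn_ord _) (ltn_ord i) Ci.
apply; first exact: ltn_ord.
by rewrite edgeD // !nnE (inj_eq val_inj) ij -du mem_int_subUU.
Qed.

(** For each [s] the binomial has one monomial in the component of [s] and one through the least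
    vertex of D_d; the functionals of the components separate these binomials. *)
Lemma sum_b0_le m : generated_by (toric_ideal K n) m ->
  (\sum_(0 <= g < T4.+1) b0 (vert (D g)) (edge (D g)) <= m)%N.
Proof.
move=> gen.
have -> : (\sum_(0 <= g < T4.+1) b0 (vert (D g)) (edge (D g)) = #|{: T}|)%N.
  have -> : #|{: T}| =
      (\sum_(g < T4.+1) \sum_(i < 4) nonroot (vert (D g)) (edge (D g)) i)%N.
    rewrite pair_bigA card_sig -sum1_card big_mkcond /=.
    by apply: eq_bigr => s _; rewrite -topredE /=; case: ifP.
  rewrite big_mkord; apply: eq_bigr => g _.
  by rewrite !big_ord_recl big_ord0 /= /b0 addn0 -!addnA.
have /choice[b bP] : forall s : T, exists b : 'X_{1..4} * 'X_{1..4},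
    [/\ mwt n b.1 = (val s).1, mwt n b.2 = (val s).1, b.1 (val s).2 != 0%N
     & forall s' : T, (val s').1 = (val s).1 -> exists2 j, b.2 j != 0%N & ~~ C s' j].
  move=> [[g i] /= /and3P[vi vlt _]].
  have [r [r4 vr rmin]] := rootP (ltn_ord i) vi.
  have := vi; rewrite vertD // => /mem_int_vertex[u [[ug] ui]].
  have := vr; rewrite vertD // => /mem_int_vertex[v [[vg] vr0]].
  rewrite inord_val in ui; exists (u, v); split=> // -[[g' i'] /= nr] gg'.
  (* The least vertex [r] lies in no component counted by [T]. *)
  exists (inord r) => //; rewrite /C /= inordK // gg'.
  move: nr; rewrite /= gg' => /and3P[_ /hasP[k]]; rewrite mem_iota /= => ki vk.
  move/hasPn; apply.
  by rewrite mem_iota /= (leq_ltn_trans (rmin k vk)).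
apply: (@generators_ge K 4 n T (fun s => (val s).1) C
   (fun s => 'X_[(b s).1] - 'X_[(b s).2])) gen => [s|s|s s'].
- exact: conn_separates.
- by have [b1 b2 _ _] := bP s; apply: toric_binomial; rewrite b1 b2.
have [b1 b2 bi bj] := bP s'; rewrite rmorphB /= !cparamX coefB.
have out (u : 'X_{1..4}) (P : bool) : mwt n u = (val s').1 -> (val s).1 != (val s').1 ->
    (if P then 'X^(mwt n u) else 0 : {poly K})`_((val s).1) = 0.
  move=> -> ss'; case: P; rewrite ?coef0 // coefXn.
  by rewrite (_ : (_ == _) = false) //; apply: negbTE.
case: (eqVneq (val s).1 (val s').1) => [ss'|ss']; last first.
  by rewrite !out // subr0; case: eqP => // ss; rewrite ss eqxx in ss'.
have [j bj0 Cj] := bj s ss'.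
rewrite [supported _ (b s').2]negbTE ?coef0 ?subr0; last first.
  by apply/forallPn; exists j; rewrite bj0.
have -> : supported (C s) (b s').1 = C s (val s').2.
  apply/idP/idP => [/forallP/(_ (val s').2)/implyP|Cs]; first exact.
  by apply: (@conn_separates s _ (val s').2) => //; rewrite b1 ss'.
rewrite b1 -ss'; suff -> : C s (val s').2 = (s == s').
  by case: (s == s'); rewrite ?coef0 // coefXn eqxx.
(* Both indices are the least vertex of the same component. *)
apply/idP/eqP => [Cs|<-]; last exact: conn_refl.
apply: val_inj; move: ss' Cs; rewrite /C.
case: s s' {b1 b2 bi bj bj0 Cj out} => [[g i] /= nr] [[g' i'] /= nr'] gg' Cs.
subst g'; congr (_, _); apply: val_inj => /=.
have [Cs' _] := conn_sym_closed (edge_graph4 (D g)) (ltn_ord _) (ltn_ord _) Cs.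
case/and3P: nr => _ _ /hasPn nr; case/and3P: nr' => _ _ /hasPn nr'.
case: (ltngtP i i') => // lt.
  by have := nr' i; rewrite mem_iota /= lt Cs' => /(_ isT).
by have := nr i'; rewrite mem_iota /= lt Cs => /(_ isT).
Qed.
End Generators.

(** For this [m] the bound [sum_b0_le] is the hypothesis of [b0_pf_complex_eq0]. *)
Lemma b0E_eq0 m d : m = (3 * (sg_type n H - 1))%N ->
  generated_by (toric_ideal K n) m -> b0 (vert (D d)) (edge (E d)) = 0%N.
Proof.
move=> mE /sum_b0_le; rewrite mE (sg_typeE HS HG) subn1 /= => le.
apply: (b0_pf_complex_eq0 (F := F)) => //.
- by move=> i _; apply: (generator_gt0 HG).
- exact: mem_int0.
- by move=> x y; apply: mem_intD.
- by move=> x; apply: mem_int_ge0.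
- by move=> i _; apply: (mem_int_generator HG).
- by move=> x; apply: mem_int_big.
- exact: h_gen4.
- by move=> x; apply: (almost_symmetricP HS HG AS).
- by move=> x; apply: (pf'_range HS HG).
- by move=> x; apply: pf'_nmem.
- exact: pfE4.
Qed.

Section Connect.
Hypothesis b00 : forall d, b0 (vert (D d)) (edge (E d)) = 0%N.

Lemma J_trans u v w : J ('X_[u] - 'X_[v]) -> J ('X_[v] - 'X_[w]) -> J ('X_[u] - 'X_[w]).
Proof. by move=> uv vw; rewrite -(subrKA 'X_[v]); apply: ideal_genD. Qed.

Lemma J_sym u v : J ('X_[u] - 'X_[v]) -> J ('X_[v] - 'X_[u]).
Proof. by move=> uv; rewrite -opprB; apply: ideal_genN. Qed.

Lemma binomial_RF d : forall u v, mwt n u = d -> mwt n v = d -> J ('X_[u] - 'X_[v]).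
Proof.
have [k] := ubnP d; elim: k d => // k IH d; rewrite ltnS => dk.
(* A common variable is cancelled, and the degree drops as [n i] is positive. *)
have same (i : 'I_4) (u v : 'X_{1..4}) : mwt n u = d -> mwt n v = d ->
    u i != 0%N -> v i != 0%N -> J ('X_[u] - 'X_[v]).
  move=> ud vd ui vi; have ni := generator_gt0 HG i.
  have ud' := mwt_subU n ui; have vd' := mwt_subU n vi.
  have addU (w : 'X_{1..4}) : w i != 0%N -> w = (U_(i) + (w - U_(i)))%MM.
    move=> wi; apply/mnmP => j; rewrite mnmDE mnmBE mnm1E.
    by case: eqP => [<-|_] /=; move: wi; lia.
  rewrite (addU u ui) (addU v vi) !mpolyXD -mulrBr; apply: ideal_genM.
  by apply: (IH (d - n i)%N); lia.
pose Q (i j : nat) := forall u v : 'X_{1..4}, mwt n u = d -> mwt n v = d ->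
  u (inord i) != 0%N -> v (inord j) != 0%N -> J ('X_[u] - 'X_[v]).
have Qsym i j : Q i j -> Q j i by move=> q u v ud vd ui vj; apply/J_sym/q.
have Qtrans i j l : vert (D d) j -> (j < 4)%N -> Q i j -> Q j l -> Q i l.
  move=> vj j4 qij qjl u v ud vd ui vl.
  have := vj; rewrite vertD // => /mem_int_vertex[w [[wd] wj]].
  exact: J_trans (qij u w ud wd ui wj) (qjl w v wd vd wj vl).
have Qedge i j : (i < 4)%N -> (j < 4)%N -> edge (E d) i j -> Q i j.
  move=> i4 j4; rewrite edgeE // => /andP[ij hp].
  have ij' : (inord j : 'I_4) != inord i.
    by rewrite -(inj_eq val_inj) /= !inordK // eq_sym.
  suff [w [w' [wd w'd wi w'j ww']]] : exists w w' : 'X_{1..4},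
      [/\ mwt n w = d, mwt n w' = d, w (inord i) != 0%N,
         w' (inord j) != 0%N & J ('X_[w] - 'X_[w'])].
    move=> u v ud vd ui vj; apply: J_trans (same (inord i) u w ud wd ui wi) _.
    exact: J_trans ww' (same (inord j) w' v w'd vd w'j vj).
  (* For an edge of D_d, one monomial contains both variables; for a new edge, [RF_connect] gives
     the link, with the indices exchanged. *)
  case/orP: hp => [|hp].
    case/mem_int_vertex => w [wd wj]; exists (U_(inord i) + w)%MM, (U_(inord i) + w)%MM.
    have wd' : mwt n (U_(inord i) + w)%MM = d by rewrite mwtD mwt1 -/(nn i); lia.
    split=> //; rewrite ?subrr; last exact: ideal_gen0.
      by rewrite mnmDE mnm1E eqxx.
    by rewrite mnmDE mnm1E addn_eq0 negb_and wj orbT.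
  have [w [w' [wd w'd wi w'j ww']]] := RF_connect K HG hp ij'.
  have wd' : mwt n w = d.
    by apply/eqP; rewrite -eqz_nat; apply/eqP; rewrite wd -!/(nn _); lia.
  by exists w, w'; split=> //; rewrite w'd.
have Qroot r : (r < 4)%N -> vert (D d) r -> (forall l, vert (D d) l -> (r <= l)%N) ->
    forall i, (i < 4)%N -> vert (D d) i -> Q i r.
  move=> r4 vr rmin i; have [l] := ubnP i.
  elim: l i => // l IHl i; rewrite ltnS => il i4 vi.
  case: (eqVneq i r) => [->|ir]; first exact: same.
  have ri : (r < i)%N by rewrite ltn_neqAle eq_sym ir rmin.
  (* Because [b0] vanishes, [i] is connected to a smaller number, and the induction descends to
     [r]. *)
  have : ~~ nonroot (vert (D d)) (edge (E d)) i.
    apply/negP => nr; have := b00 d; rewrite /b0.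
    by case: i i4 nr {il vi ir ri} => [|[|[|[|i]]]] // _ ->; lia.
  rewrite /nonroot vi /= negb_and; case/orP => [/hasPn/(_ r)|].
    by rewrite mem_iota /= ri vr => /(_ isT).
  rewrite negbK => /hasP[j]; rewrite mem_iota /= => ji cij.
  have j4 : (j < 4)%N by apply: ltn_trans i4.
  have [vj Qij] : vert (D d) j /\ Q i j.
    apply: (@conn_ind (edge (E d)) (fun j => vert (D d) j /\ Q i j) i) => //.
      by split=> //; apply: same.
    move=> a c a4 c4 [va Qia] eac; split; last exact: Qtrans Qia (Qedge _ _ a4 c4 eac).
    suff /andP[] : vert (D d) a && vert (D d) c by [].
    apply: (edgeE_vert (F := F)) eac => //.
      by move=> x y; apply: mem_intD.
      by move=> s _; apply: (mem_int_generator HG).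
      exact: pfE4.
  by apply: Qtrans Qij _ => //; apply: IHl => //; apply: leq_trans il.
move=> u v ud vd.
have zero (w : 'X_{1..4}) : mwt n w = d -> (forall i, w i = 0%N) -> d = 0%N.
  by move=> <- w0; rewrite /mwt big1 // => i _; rewrite w0.
have nz (w : 'X_{1..4}) : mwt n w = d -> d != 0%N -> exists i, w i != 0%N.
  move=> wd d0; apply/existsP; apply: contraNT d0 => /existsPn nw.
  apply/eqP/(zero w wd) => i.
  by apply/eqP; rewrite -[_ == _]negbK nw.
have z (w : 'X_{1..4}) : mwt n w = 0%N -> w = 0%MM.
  move=> w0; apply/mnmP => i; rewrite mnm0E; apply/eqP; apply: contraT => wi.
  by have := mwt_subU n wi; rewrite w0; have := generator_gt0 HG i; lia.
case: (eqVneq d 0%N) => [d0|d0].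
  have -> : u = v.
    by transitivity (0%MM : 'X_{1..4}); [|symmetry]; apply: z; rewrite ?ud ?vd.
  by rewrite subrr; apply: ideal_gen0.
have [i ui] := nz u ud d0; have [j vj] := nz v vd d0.
have vert_of (w : 'X_{1..4}) (l : 'I_4) : mwt n w = d -> w l != 0%N -> vert (D d) l.
  by move=> wd wl; rewrite vertD // nnE -wd; apply: mem_int_subU.
have vi := vert_of u i ud ui; have vj' := vert_of v j vd vj.
have [r [r4 vr rmin]] := rootP (ltn_ord i) vi.
have Qij : Q i j by apply: (Qtrans _ r) => //; [|apply: Qsym]; apply: Qroot.
by apply: Qij; rewrite ?inord_val.
Qed.
End Connect.
End FourGenerators.

Theorem theorem6p4 (K : fieldType) (n : 'I_4 -> nat) (H : set nat) (m : nat) :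
  numerical_semigroup H ->
  minimally_generated n H ->
  almost_symmetric n H ->
  m = (3 * (sg_type n H - 1))%N ->
  generated_by (toric_ideal K n) m ->
  ideal_gen (RF_relation K n H) = toric_ideal K n.
Proof.
move=> HS HG AS mE gen; apply/predeqP => q; split=> [[k [c [s [sRF ->]]]]|].
  rewrite /toric_ideal /= param_mapE rmorph_sum big1 // => i _.
  exact: (toric_idealM (c i) (RF_relation_toric (sRF i))).
apply: toric_sub_ideal_gen => u v uv.
apply: (binomial_RF K HS HG _ (erefl (mwt n u)) (esym uv)) => d.
exact: b0E_eq0 mE gen.
Qed.
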